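(* Let $U_T$ be the tail quantile function of the truncated Pareto-type distribution $F_T$ with truncation point $T$ (all notation as defined in the context). (a) If $yD_T$ is bounded away from $0$ as $y,T\to\infty$, then $$U_T(y)=T\left(1+\frac{1}{D_Ty}\right)^{-1/\alpha}\left\{\ell(T)\,\ell^*(T\ell(T))\right\}\frac{\ell^*\left(T\ell(T)\left[1+\frac{1}{D_Ty}\right]^{-1/\alpha}\right)}{\ell^*(T\ell(T))},$$ where $\ell(T)\,\ell^*(T\ell(T))\to 1$ and $\dfrac{\ell^*\left(T\ell(T)\left[1+\frac{1}{D_Ty}\right]^{-1/\alpha}\right)}{\ell^*(T\ell(T))}\to 1$. (b) If $yD_T\to 0$ as $y,T\to\infty$, then $$U_T(y)=(yC_T)^{1/\alpha}\,\ell^*\left((yC_T)^{1/\alpha}\right)(1+D_Ty)^{-1/\alpha}\,\frac{\ell^*\left((yC_T)^{1/\alpha}[1+D_Ty]^{-1/\alpha}\right)}{\ell^*\left((yC_T)^{1/\alpha}\right)},$$ where $\dfrac{\ell^*\left((yC_T)^{1/\alpha}[1+D_Ty]^{-1/\alpha}\right)}{\ell^*\left((yC_T)^{1/\alpha}\right)}\to 1$.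
   Context: Model. Let $\alpha>0$, let $\tau>0$ be a fixed lower bound, and let $1-F(x)=x^{-\alpha}\ell_F(x)$ be a Pareto-type tail function, where $\ell_F$ is slowly varying at infinity ($\ell_F(tx)/\ell_F(t)\to1$ as $t\to\infty$ for every $x>0$). For a truncation point $T>\tau$ the truncated Pareto-type distribution $F_T$ on $(\tau,T)$ is given by $$1-F_T(x)=C_T\left(x^{-\alpha}\ell_F(x)-T^{-\alpha}\ell_F(T)\right),\qquad C_T=\left(\tau^{-\alpha}\ell_F(\tau)-T^{-\alpha}\ell_F(T)\right)^{-1},$$ and $F_T$ is assumed continuous. Notation. $Q_T(p)=\inf\{x:F_T(x)\ge p\}$ and $U_T(y)=Q_T(1-1/y)$ for $y>1$. Put $\ell=\ell_F^{-1/\alpha}$ (so $\ell^{-\alpha}=\ell_F$) and $D_T=C_T\,(T\ell(T))^{-\alpha}$. $\ell^*$ denotes the de Bruyn conjugate of $\ell$: a slowly varying function with $\ell(x)\,\ell^*(x\ell(x))\to1$ as $x\to\infty$, taken in the version for which the equation $s=x\ell(x)$ is solved by $x=s\,\ell^*(s)$, i.e. $\ell^*(s)=s^{-1}\inf\{x:x\ell(x)\ge s\}$. *)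

(* Defs.v *)
From mathcomp Require Import all_boot all_order all_algebra.
From mathcomp Require Import all_classical all_reals all_analysis.
Import Order.TTheory GRing.Theory Num.Theory.
Import numFieldTopology.Exports numFieldNormedType.Exports.

Set Implicit Arguments.
Unset Strict Implicit.
Unset Printing Implicit Defensive.

Local Open Scope classical_set_scope.
Local Open Scope ring_scope.

Definition slowly_varying (R : realType) (f : R -> R) : Prop :=
  forall x : R, 0 < x -> f (x * t) / f t @[t --> +oo] --> (1 : R).

(* 1 - F(x) = x^(-alpha) ellF(x).  Any distribution function F determines ellF
   on (0, +oo) through this equation; that ellF is positive there follows from
   slow variation and the monotonicity of F. *)
Definition pareto_type (R : realType) (F : R -> R) (alpha : R) (ellF : R -> R)
    : Prop :=
  slowly_varying ellF /\
  forall x : R, 0 < x -> 1 - F x = x `^ (- alpha) * ellF x.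

Section TruncatedPareto.
Variables (R : realType) (alpha tau : R) (ellF : R -> R).

Definition C_trunc (T : R) : R :=
  (tau `^ (- alpha) * ellF tau - T `^ (- alpha) * ellF T)^-1.

(* If the denominator of C_trunc T vanishes (no mass between tau and T), then
   C_trunc T = 0 and F_trunc T jumps from 0 to 1 at tau; continuity of F_trunc T
   thus excludes this degenerate case. *)
Definition F_trunc (T x : R) : R :=
  if x <= tau then 0
  else if T <= x then 1
  else 1 - C_trunc T * (x `^ (- alpha) * ellF x - T `^ (- alpha) * ellF T).

Definition Q_trunc (T p : R) : R := inf [set x | p <= F_trunc T x].

Definition U_trunc (T y : R) : R := Q_trunc T (1 - y^-1).

Definition ell (x : R) : R := ellF x `^ (- alpha^-1).

Definition D_trunc (T : R) : R := C_trunc T * (T * ell T) `^ (- alpha).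

End TruncatedPareto.

(* The version of the de Bruyn conjugate of l given by the generalized inverse
   of x |-> x * l x on (0, +oo). *)
Definition de_bruyn (R : realType) (l : R -> R) (s : R) : R :=
  s^-1 * inf [set x | 0 < x /\ s <= x * l x].

(* Main.v *)
Require Import Defs.
From mathcomp Require Import all_boot all_order all_algebra.
From mathcomp Require Import all_classical all_reals all_analysis.
From mathcomp Require Import ring lra.
Import Order.TTheory GRing.Theory Num.Theory.
Import numFieldTopology.Exports numFieldNormedType.Exports.

Set Implicit Arguments.
Unset Strict Implicit.
Unset Printing Implicit Defensive.

Local Open Scope classical_set_scope.
Local Open Scope ring_scope.

(** Write k x = x * ell x.  Since 1 - F x = x^(-alpha) * ellF x, one has
    k x = (1 - F x)^(-1/alpha): k is nondecreasing on (0, +oo), tends to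
    infinity, and satisfies k (x t) / k t -> x because ell is slowly varying.
    By definition s * ell^*(s) is the generalized inverse of k at s.

    Exact formulas.  Between tau and T, the inequality F_T x >= 1 - 1/y unfolds
    to 1 - F x <= w, with w = 1 - F T + 1/(y C_T).  As y > 1, w lies strictly
    between 1 - F T and 1 - F tau, so the same equivalence persists below tau
    (both sides fail) and above T (both hold).  Hence U_T(y) is the generalized
    inverse of k at s = w^(-1/alpha), that is U_T(y) = s * ell^*(s)
    ([U_trunc_de_bruyn]).  Since D_T = C_T (1 - F T), the level w factors as
    (1 - F T) (1 + 1/(D_T y)) and as (1 + D_T y) / (y C_T), which gives the two
    expressions of s in (a) and (b).  The remaining factors of the two formulas
    cancel because ell^* does not vanish at the points where one divides by it.
    Continuity of F_T at tau forces F tau < F T, so that C_T is a positive number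
    and the bounds on w are strict.

    Limits.  ell(T) * ell^*(T ell(T)) is (generalized inverse of k at k T) / T,
    which tends to 1 because k (q T) < k T eventually for each q < 1
    ([gen_inv_cvg_id]).  Both quotients of values of ell^* have the form
    ell^*(s r) / ell^*(s) with s -> +oo and r confined to a segment [p, 1],
    p > 0: in (a) because D_T y >= c, in (b) because D_T y <= 1 eventually.
    They tend to 1 because ell^* is slowly varying, locally uniformly on
    (0, +oo) ([gen_inv_scale_unif], [de_bruyn_cvg_scale]). *)

(** * Generalized inverses of regularly varying functions *)

Definition gen_inv {R : realType} (k : R -> R) (s : R) : R :=
  inf [set x | 0 < x /\ s <= k x].

Section GeneralizedInverse.
Context (R : realType) (k : R -> R).
Hypothesis k_nd : forall x z : R, 0 < x -> x <= z -> k x <= k z.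
Hypothesis k_y : k x @[x --> +oo] --> +oo.

Lemma gen_inv_set_neq0 s : [set x | 0 < x /\ s <= k x] !=set0.
Proof.
near (+oo : set_system R) => x; exists x; split; near: x.
  exact: nbhs_pinfty_gt.
exact: (cvgry_ge k_y s).
Unshelve. all: by end_near. Qed.

Lemma gen_inv_le x s : 0 < x -> s <= k x -> gen_inv k s <= x.
Proof.
move=> x0 sx; apply: ge_inf; last by split.
by exists 0 => z [/ltW].
Qed.

Lemma gen_inv_lt x s : gen_inv k s < x -> s <= k x.
Proof.
move=> /(inf_lt (gen_inv_set_neq0 s))[z [z0 sz] zx].
by apply: le_trans sz (k_nd z0 (ltW zx)).
Qed.

Lemma gen_inv_ge a s : k a < s -> a <= gen_inv k s.
Proof.
move=> ka; rewrite leNgt; apply/negP => /gen_inv_lt.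
by rewrite leNgt ka.
Qed.

Lemma gen_inv_cvgy : gen_inv k s @[s --> +oo] --> +oo.
Proof.
apply/cvgryPge => a; near=> s; apply: gen_inv_ge; near: s.
by apply: nbhs_pinfty_gt; exact: num_real.
Unshelve. all: by end_near. Qed.

Hypothesis k_rv : forall x : R, 0 < x -> k (x * t) / k t @[t --> +oo] --> x.

Let k_gt0 : \forall t \near +oo, 0 < k t.
Proof. exact: (cvgry_gt k_y 0). Qed.

(** With g = gen_inv k and q slightly above 1, k (q * g s) >= s, and regular
    variation of k turns this into k (m * q * g s) >= a * s for m > a.  The
    lower bound [gen_inv_scale_ge] follows by replacing s with a * s. *)
Lemma gen_inv_scale_le a b : 0 < a -> a < b ->
  \forall s \near +oo, gen_inv k (a * s) <= b * gen_inv k s.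
Proof.
move=> a0 ab; set m := (a + b) / 2.
have am : a < m by rewrite /m; lra.
have mb : m < b by rewrite /m; lra.
have m0 : 0 < m by exact: lt_trans am.
(* b = m * q splits the room between a and b into two factors. *)
pose q := b / m.
have q1 : 1 < q by rewrite /q ltr_pdivlMr// mul1r.
have q0 : 0 < q by exact: lt_trans q1.
have kam : \forall t \near +oo, a * k t <= k (m * t).
  near=> t; rewrite -ler_pdivlMr//; last by near: t.
  by near: t; exact: (cvgr_ge _ (k_rv m0) _ am).
have qinv : q * gen_inv k s @[s --> +oo] --> +oo.
  exact: gt0_cvgMry gen_inv_cvgy.
have g0 : \forall s \near +oo, 0 < gen_inv k s.
  exact: (cvgry_gt gen_inv_cvgy 0).
near=> s.
have gs0 : 0 < gen_inv k s by near: s.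
have -> : b * gen_inv k s = m * (q * gen_inv k s).
  by rewrite mulrA /q mulrCA divff ?gt_eqF// mulr1.
apply: gen_inv_le; first by do 2 apply: mulr_gt0 => //.
apply: (@le_trans _ _ (a * k (q * gen_inv k s))).
  rewrite ler_pM2l//; apply: gen_inv_lt.
  by rewrite ltr_pMl.
by near: s; exact: qinv kam.
Unshelve. all: by end_near. Qed.

Lemma gen_inv_scale_ge a b : 0 < b -> b < a ->
  \forall s \near +oo, b * gen_inv k s <= gen_inv k (a * s).
Proof.
move=> b0 ba; have a0 : 0 < a by exact: lt_trans ba.
have as_y : a * s @[s --> +oo] --> +oo by exact: gt0_cvgMry.
have ab' : a^-1 < b^-1 by rewrite ltf_pV2 ?posrE.
have ai : 0 < a^-1 by rewrite invr_gt0.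
near=> s; rewrite -ler_pdivlMl// -{1}(mulKf (lt0r_neq0 a0) s).
by near: s; exact: as_y (gen_inv_scale_le ai ab').
Unshelve. all: by end_near. Qed.

Lemma gen_inv_nd : {homo gen_inv k : s u / s <= u}.
Proof.
move=> s u su; apply: lb_le_inf; first exact: gen_inv_set_neq0.
by move=> x [x0 ux]; apply: gen_inv_le => //; exact: le_trans ux.
Qed.

(** Uniform convergence on segments: monotonicity of the generalized inverse
    controls every r in (rho / d, rho * d) by the two endpoints, to which
    [gen_inv_scale_le] and [gen_inv_scale_ge] apply, and compactness leaves
    finitely many rho. *)
Lemma gen_inv_scale_unif (p q e : R) : 0 < p -> 0 < e ->
  \forall s \near +oo, forall r, `[p, q]%classic r ->
    `|1 - gen_inv k (r * s) / (r * gen_inv k s)| <= e.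
Proof.
move=> p0 e0; pose x := Num.min e 1 / 7; pose d := 1 + x.
have x0 : 0 < x by rewrite divr_gt0// lt_min e0/=.
have d1 : 1 < d by rewrite /d ltrDl.
have d0 : 0 < d by exact: lt_trans d1.
(* The division by 7 comes from (1 + x)^3 <= 1 + 7 x on [0, 1]. *)
have d3 : d * (d * d) <= 1 + e.
  have xe : 7 * x <= e by rewrite /x mulrC divfK// ge_min lexx.
  have x1 : 7 * x <= 1 by rewrite /x mulrC divfK// ge_min lexx orbT.
  by rewrite /d; nra.
have /compact_near_coveringP K := @segment_compact _ p q.
apply: K => rho /=; rewrite in_itv/= => /andP[prho _].
have rho0 : 0 < rho by exact: lt_le_trans prho.
have dn1 : d^-1 < 1 by rewrite invf_lt1.
pose b := rho / d / d.
have b0 : 0 < b by rewrite !divr_gt0.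
have rhoE : rho = b * (d * d) by rewrite /b mulrA !divfK ?gt_eqF.
have up : \forall s \near +oo,
    gen_inv k (rho * d * s) <= rho * d * d * gen_inv k s.
  by apply: gen_inv_scale_le; rewrite ?ltr_pMr// mulr_gt0.
have lo : \forall s \near +oo, b * gen_inv k s <= gen_inv k (rho / d * s).
  by apply: gen_inv_scale_ge; rewrite // gtr_pMr// divr_gt0.
near=> r s.
have rlt : r < rho * d by near: r; apply: lt_nbhsl; rewrite ltr_pMr.
have rgt : rho / d < r by near: r; apply: lt_nbhsr; rewrite gtr_pMr.
have r0 : 0 < r by apply: lt_trans rgt; rewrite divr_gt0.
have s0 : 0 < s by near: s; exact: nbhs_pinfty_gt.
have g0 : 0 < gen_inv k s by near: s; exact: (cvgry_gt gen_inv_cvgy 0).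
have rg0 : 0 < r * gen_inv k s by rewrite mulr_gt0.
have hup : gen_inv k (r * s) <= rho * d * d * gen_inv k s.
  apply: (@le_trans _ _ (gen_inv k (rho * d * s))); last by near: s.
  by apply: gen_inv_nd; rewrite ler_pM2r// ltW.
have hlo : b * gen_inv k s <= gen_inv k (r * s).
  apply: (@le_trans _ _ (gen_inv k (rho / d * s))); first by near: s.
  by apply: gen_inv_nd; rewrite ler_pM2r// ltW.
have le_up : gen_inv k (r * s) / (r * gen_inv k s) <= 1 + e.
  rewrite ler_pdivrMr// mulrA; apply: le_trans hup _; rewrite ler_pM2r//.
  have rd : rho <= r * d by rewrite -ler_pdivrMr// ltW.
  apply: (@le_trans _ _ (d * (d * d) * r)); last by rewrite ler_pM2r.
  have -> : d * (d * d) * r = r * d * (d * d) by ring.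
  by rewrite -mulrA ler_pM2r// mulr_gt0.
have le_lo : 1 - e <= gen_inv k (r * s) / (r * gen_inv k s).
  rewrite ler_pdivlMr// mulrA; apply: le_trans hlo; rewrite ler_pM2r//.
  have [e1|e1] := leP 1 e.
    by apply: le_trans (ltW b0); rewrite mulr_le0_ge0 ?subr_le0// ltW.
  have rb : r <= b * (d * (d * d)).
    by rewrite (mulrC d) mulrA -rhoE ltW.
  nra.
by rewrite ler_norml; apply/andP; split; lra.
Unshelve. all: by end_near. Qed.

(** gen_inv k (k t) <= t always; it can be smaller than t when k is constant to
    the left of t, but not below q * t, as k (q * t) < k t for large t. *)
Lemma gen_inv_cvg_id : gen_inv k (k t) / t @[t --> +oo] --> (1 : R).
Proof.
apply/cvgrPdist_le => e e0; pose q := Num.max (1 - e) (1 / 2).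
(* The bound 1 / 2 keeps q positive when e >= 1. *)
have q0 : 0 < q by rewrite /q lt_max; apply/orP; right; lra.
have q1 : q < 1 by rewrite /q gt_max; apply/andP; split; lra.
near=> t.
have t0 : 0 < t by near: t; exact: nbhs_pinfty_gt.
have kt0 : 0 < k t by near: t.
have le1 : gen_inv k (k t) / t <= 1.
  by rewrite ler_pdivrMr// mul1r gen_inv_le.
have geq : q <= gen_inv k (k t) / t.
  rewrite ler_pdivlMr//; apply: gen_inv_ge.
  rewrite -[ltRHS]mul1r -ltr_pdivrMr//.
  by near: t; exact: (cvgr_lt _ (k_rv q0) _ q1).
have : 1 - e <= q by rewrite /q le_max lexx.
by rewrite ger0_norm ?subr_ge0//; lra.
Unshelve. all: by end_near. Qed.

End GeneralizedInverse.

(** * The de Bruyn conjugate *)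

Lemma de_bruynE {R : realType} (l : R -> R) s : s != 0 ->
  s * de_bruyn l s = gen_inv (fun x => x * l x) s.
Proof. by move=> s0; rewrite /de_bruyn mulVKf. Qed.

Section DeBruynConjugate.
Context (R : realType) (l : R -> R).
Let k x := x * l x.
Hypothesis k_nd : forall x z : R, 0 < x -> x <= z -> k x <= k z.
Hypothesis k_y : k x @[x --> +oo] --> +oo.
Hypothesis l_sv : slowly_varying l.

Let k_rv (x : R) : 0 < x -> k (x * t) / k t @[t --> +oo] --> x.
Proof.
move=> x0; rewrite -[X in _ --> X]mulr1.
have : x * (l (x * t) / l t) @[t --> +oo] --> x * 1.
  by apply: cvgM; [exact: cvg_cst|exact: l_sv].
apply: cvg_trans; apply: near_eq_cvg; near=> t.
have t0 : t != 0.
  by apply: lt0r_neq0; near: t; exact: nbhs_pinfty_gt.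
by rewrite /k invfM (mulrACA (x * t)) mulfK.
Unshelve. all: by end_near. Qed.

Lemma de_bruyn_cvg_scale (I : Type) (G : set_system I) (s r : I -> R)
    (p q : R) : Filter G -> 0 < p ->
  s i @[i --> G] --> +oo -> (\forall i \near G, p <= r i <= q) ->
  de_bruyn l (s i * r i) / de_bruyn l (s i) @[i --> G] --> (1 : R).
Proof.
move=> FG p0 sy rpq; apply/cvgrPdist_le => e e0.
have unif : \forall i \near G, forall u, `[p, q]%classic u ->
    `|1 - gen_inv k (u * s i) / (u * gen_inv k (s i))| <= e.
  exact: sy _ (gen_inv_scale_unif k_nd k_y k_rv q p0 e0).
near=> i.
have /andP[pr rq] : p <= r i <= q by near: i.
have r0 : 0 < r i by exact: lt_le_trans pr.
have s0 : 0 < s i by near: i; exact: (cvgry_gt sy 0).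
have -> : de_bruyn l (s i * r i) / de_bruyn l (s i) =
    gen_inv k (r i * s i) / (r i * gen_inv k (s i)).
  rewrite /de_bruyn -/(gen_inv k _) -/(gen_inv k _) (mulrC (s i)) !invfM invrK.
  by rewrite mulrACA -(mulrA (r i)^-1) mulVf ?gt_eqF// mulr1 mulrCA mulrA.
have : `[p, q]%classic (r i) by rewrite /= in_itv/= pr.
by move: (r i); near: i.
Unshelve. all: by end_near. Qed.

Lemma de_bruyn_cvg_self : l t * de_bruyn l (t * l t) @[t --> +oo] --> (1 : R).
Proof.
apply: cvg_trans (gen_inv_cvg_id k_nd k_y k_rv).
apply: near_eq_cvg; near=> t.
have t0 : t != 0.
  by apply: lt0r_neq0; near: t; exact: nbhs_pinfty_gt.
have kt0 : k t != 0.
  by apply: lt0r_neq0; near: t; exact: (cvgry_gt k_y 0).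
have -> : l t * de_bruyn l (t * l t) = t^-1 * (k t * de_bruyn l (k t)).
  by rewrite /k !mulrA mulVf// mul1r.
by rewrite de_bruynE// mulrC.
Unshelve. all: by end_near. Qed.

(** The value of the conjugate is zero exactly when the infimum defining it is,
    which happens if k stays above s near 0; a point a with k a < s rules this
    out. *)
Lemma de_bruyn_neq0 a s : 0 < a -> 0 < s -> k a < s -> de_bruyn l s != 0.
Proof.
move=> a0 s0 kas; rewrite mulf_neq0 ?invr_eq0 ?gt_eqF//.
exact: lt_le_trans (gen_inv_ge k_nd k_y kas).
Qed.

End DeBruynConjugate.

(** * Real powers *)

Lemma powRV {R : realType} (x p : R) : 0 <= x -> x^-1 `^ p = x `^ (- p).
Proof. by move=> x0; rewrite -powR_inv1// -powRrM mulN1r. Qed.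

Lemma powRK {R : realType} (x p : R) : 0 <= x -> p != 0 ->
  (x `^ p) `^ p^-1 = x.
Proof. by move=> x0 p0; rewrite -powRrM divff// powRr1. Qed.

Lemma le_powRN {R : realType} (p x z : R) : 0 < p -> 0 < x -> 0 < z ->
  (x `^ (- p) <= z `^ (- p)) = (z <= x).
Proof.
move=> p0 x0 z0; rewrite !powRN lef_pV2 ?posrE ?powR_gt0//.
have [zx|xz] := leP z x.
  by rewrite ge0_ler_powR ?nnegrE ?(ltW p0) ?(ltW x0) ?(ltW z0).
by apply/negbTE; rewrite -ltNge gt0_ltr_powR ?nnegrE ?(ltW x0) ?(ltW z0).
Qed.

Lemma powRN_le1 {R : realType} (p x : R) : 0 < p -> 1 <= x -> x `^ (- p) <= 1.
Proof.
move=> p0 x1; have <- : 1 `^ (- p) = 1 by rewrite powR1.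
by rewrite le_powRN// (lt_le_trans ltr01).
Qed.

Lemma powR_cvg1 {R : realType} (I : Type) (G : set_system I) (f : I -> R) p :
  Filter G -> f i @[i --> G] --> (1 : R) -> f i `^ p @[i --> G] --> (1 : R).
Proof.
move=> FG f1.
have : expR (p * ln (f i)) @[i --> G] --> expR (p * ln 1).
  apply: continuous_cvg; first exact: continuous_expR.
  apply: cvgM; [exact: cvg_cst|apply: continuous_cvg => //].
  exact: continuous_ln.
rewrite ln1 mulr0 expR0; apply: cvg_trans; apply: near_eq_cvg; near=> i.
have f0 : 0 < f i by near: i; exact: (cvgr_gt _ f1 _ ltr01).
by rewrite /powR gt_eqF.
Unshelve. all: by end_near. Qed.

Lemma powR_cvgy {R : realType} (I : Type) (G : set_system I) (f : I -> R) p :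
  Filter G -> 0 < p -> f i @[i --> G] --> +oo -> f i `^ p @[i --> G] --> +oo.
Proof.
move=> FG p0 fy; apply/cvgryPge => A; pose B := Num.max A 1.
have B0 : 0 < B by rewrite lt_max ltr01 orbT.
have pV0 : p^-1 != 0 by rewrite invr_eq0 gt_eqF.
near=> i; apply: (@le_trans _ _ B); first by rewrite le_max lexx.
rewrite -(powRK (ltW B0) pV0) invrK.
have Bf : B `^ p^-1 <= f i by near: i; exact: (cvgry_ge fy).
have f0 : 0 <= f i by apply: le_trans Bf; exact: powR_ge0.
by rewrite ge0_ler_powR ?nnegrE ?powR_ge0 ?(ltW p0).
Unshelve. all: by end_near. Qed.

(** * Pareto-type distributions *)

Section ParetoType.
Context (R : realType) (alpha : R) (F : cumulativeBounded (0 : R) (1 : R)).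
Context (ellF : R -> R).
Hypothesis alpha_gt0 : 0 < alpha.
Hypothesis F_pareto : pareto_type F alpha ellF.
Let l := ell alpha ellF.

Lemma F_le x z : x <= z -> F x <= F z.
Proof. by move=> xz; exact: cumulative_is_nondecreasing. Qed.

Lemma F_le1 x : F x <= 1.
Proof.
have F1 := cumulativey F.
have : F x <= lim (F z @[z --> +oo]); last by rewrite (cvg_lim _ F1).
apply: limr_ge; first by apply/cvg_ex; exists 1.
by near=> z; apply: F_le; near: z; apply: nbhs_pinfty_ge; exact: num_real.
Unshelve. all: by end_near. Qed.

(** If F reached 1, ellF would vanish from there on, and so would the quotient
    ellF (1 * t) / ellF t, whose limit is 1. *)
Lemma pareto_tail_gt0 x : 0 < 1 - F x.
Proof.
have [sv FE] := F_pareto.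
near (+oo : set_system R) => t.
have t0 : 0 < t by near: t; exact: nbhs_pinfty_gt.
have xt : x <= t by near: t; apply: nbhs_pinfty_ge; exact: num_real.
have : 0 < ellF (1 * t) / ellF t.
  by near: t; exact: (cvgr_gt _ (sv 1 ltr01) _ ltr01).
have [->|lt0 _] := eqVneq (ellF t) 0; first by rewrite invr0 mulr0 ltxx.
have Ft : 1 - F t != 0 by rewrite FE// mulf_neq0// gt_eqF// powR_gt0.
have Ft1 := F_le1 t; have Fxt := F_le xt.
suff : 0 < 1 - F t by lra.
by rewrite lt_neqAle eq_sym Ft subr_ge0.
Unshelve. all: by end_near. Qed.

Lemma ellF_gt0 x : 0 < x -> 0 < ellF x.
Proof.
move=> x0; have := pareto_tail_gt0 x.
by rewrite F_pareto.2// pmulr_rgt0// powR_gt0.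
Qed.

Lemma mul_ellE x : 0 < x -> x * l x = (1 - F x) `^ (- alpha^-1).
Proof.
move=> x0; rewrite F_pareto.2// powRM ?powR_ge0 ?ltW ?ellF_gt0//.
by rewrite -powRrM mulrNN divff ?gt_eqF// powRr1// ltW.
Qed.

Lemma mul_ell_nd x z : 0 < x -> x <= z -> x * l x <= z * l z.
Proof.
move=> x0 xz; have z0 := lt_le_trans x0 xz.
rewrite !mul_ellE// le_powRN ?invr_gt0 ?pareto_tail_gt0//.
by rewrite lerD2l lerN2 F_le.
Qed.

Lemma mul_ell_cvgy : x * l x @[x --> +oo] --> +oo.
Proof.
have F1 : 1 - F x @[x --> +oo] --> (1 - 1 : R).
  by apply: cvgB; [exact: cvg_cst|exact: cumulativey].
rewrite subrr in F1.
have FV : (1 - F x)^-1 @[x --> +oo] --> +oo.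
  apply/gtr0_cvgV0; first by near=> x; rewrite invr_gt0 pareto_tail_gt0.
  by apply: cvg_trans F1; apply: near_eq_cvg; near=> x; rewrite /= invrK.
have aV0 : 0 < alpha^-1 by rewrite invr_gt0.
apply: cvg_trans (powR_cvgy _ aV0 FV); apply: near_eq_cvg; near=> x.
have x0 : 0 < x by near: x; exact: nbhs_pinfty_gt.
by rewrite mul_ellE// powRV// ltW// pareto_tail_gt0.
Unshelve. all: by end_near. Qed.

Lemma ell_slowly_varying : slowly_varying l.
Proof.
move=> x x0.
have h : (ellF (x * t) / ellF t) `^ (- alpha^-1) @[t --> +oo] --> (1 : R).
  by apply: powR_cvg1; exact: F_pareto.1.
apply: cvg_trans h; apply: near_eq_cvg; near=> t.
have t0 : 0 < t by near: t; exact: nbhs_pinfty_gt.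
rewrite /l /ell powRM ?invr_ge0 ?ltW ?ellF_gt0 ?mulr_gt0//.
by rewrite powRV ?ltW ?ellF_gt0// powRN.
Unshelve. all: by end_near. Qed.

End ParetoType.

(** * The truncated distribution *)

Section Truncation.
Context (R : realType) (alpha tau : R) (F : cumulativeBounded (0 : R) (1 : R)).
Context (ellF : R -> R).
Hypothesis alpha_gt0 : 0 < alpha.
Hypothesis tau_gt0 : 0 < tau.
Hypothesis F_pareto : pareto_type F alpha ellF.
Hypothesis FT_continuous : forall T : R, tau < T ->
  continuous (F_trunc alpha tau ellF T).
Let l := ell alpha ellF.
Let C := C_trunc alpha tau ellF.
Let D := D_trunc alpha tau ellF.

Lemma C_truncE T : tau < T -> C T = (F T - F tau)^-1.
Proof.
move=> tT; have T0 := lt_trans tau_gt0 tT.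
by rewrite /C /C_trunc -!F_pareto.2//; congr (_^-1); ring.
Qed.

(** If F tau = F T, then C_T is the inverse of zero, hence zero, and F_T jumps
    from 0 to 1 at tau. *)
Lemma F_tau_lt T : tau < T -> F tau < F T.
Proof.
move=> tT; rewrite lt_neqAle F_le ?ltW// andbT; apply/negP => /eqP FtT.
have C0 : C_trunc alpha tau ellF T = 0.
  by rewrite -/C C_truncE// FtT subrr invr0.
have F0 : F_trunc alpha tau ellF T tau = 0 by rewrite /F_trunc lexx.
have ct : F_trunc alpha tau ellF T x @[x --> tau^'+] --> (0 : R).
  rewrite -F0; apply: cvg_at_right_filter; exact: FT_continuous.
near tau^'+ => x.
have : F_trunc alpha tau ellF T x < 1.
  by near: x; exact: (cvgr_lt _ ct _ ltr01).
have tx : tau < x by near: x; exact: nbhs_right_gt.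
by rewrite /F_trunc leNgt tx/= C0 mul0r subr0 if_same ltxx.
Unshelve. all: by end_near. Qed.

Lemma C_gt0 T : tau < T -> 0 < C T.
Proof. by move=> tT; rewrite C_truncE// invr_gt0 subr_gt0 F_tau_lt. Qed.

Lemma D_truncE T : tau < T -> D T = C T * (1 - F T).
Proof.
move=> tT; have T0 := lt_trans tau_gt0 tT.
rewrite /D /D_trunc (mul_ellE alpha_gt0 F_pareto T0) -/C -powRrM mulrNN.
by rewrite mulVf ?gt_eqF// powRr1// ltW// (pareto_tail_gt0 F_pareto).
Qed.

Lemma level_lt T y : tau < T -> 1 < y ->
  1 - F T + (y * C T)^-1 < 1 - F tau.
Proof.
move=> tT y1; have := F_tau_lt tT; rewrite -subr_gt0 => Ft0.
rewrite C_truncE// invfM invrK.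
have : y^-1 * (F T - F tau) < 1 * (F T - F tau).
  by rewrite ltr_pM2r// invf_lt1// (lt_trans ltr01).
lra.
Qed.

(** The super-level set of F_T defining the quantile is equal, as a set, to the
    one defining the generalized inverse: outside (tau, T), where F_T is no
    longer an affine function of F, the bounds 1 - F T < w < 1 - F tau on the
    level w settle the matter. *)
Lemma U_truncE T y : tau < T -> 1 < y ->
  U_trunc alpha tau ellF T y =
  gen_inv (fun x => x * l x) ((1 - F T + (y * C T)^-1) `^ (- alpha^-1)).
Proof.
move=> tT y1; have T0 := lt_trans tau_gt0 tT.
have y0 := lt_trans ltr01 y1.
have CT0 := C_gt0 tT.
have lev := level_lt tT y1.
have yC0 : 0 < (y * C T)^-1 by rewrite invr_gt0 mulr_gt0.
have w0 : 0 < 1 - F T + (y * C T)^-1.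
  by rewrite addr_gt0// (pareto_tail_gt0 F_pareto).
have levE x : 0 < x ->
    ((1 - F T + (y * C T)^-1) `^ (- alpha^-1) <= x * l x) =
    (1 - F x <= 1 - F T + (y * C T)^-1).
  move=> x0; rewrite (mul_ellE alpha_gt0 F_pareto)//.
  by rewrite le_powRN ?invr_gt0// (pareto_tail_gt0 F_pareto).
rewrite /U_trunc /Q_trunc /gen_inv; congr inf; apply/seteqP; split => x /=.
- rewrite /F_trunc; case: (leP x tau) => xt.
    by rewrite subr_le0 leNgt invf_lt1// y1.
  have x0 := lt_trans tau_gt0 xt.
  case: (leP T x) => xT h; split => //; rewrite levE//.
    by have := F_le F xT; lra.
  move: h; rewrite -!F_pareto.2// -/C lerD2l lerN2 => h.
  have : 1 - F x - (1 - F T) <= (y * C T)^-1.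
    by rewrite invfM ler_pdivlMr// mulrC.
  lra.
- move=> [x0]; rewrite levE// => h; rewrite /F_trunc.
  case: (leP x tau) => xt; first by have := F_le F xt; lra.
  case: (leP T x) => xT; first by rewrite lerBlDr lerDl invr_ge0 ltW.
  rewrite -!F_pareto.2// -/C lerD2l lerN2 mulrC -ler_pdivlMr// -invfM.
  lra.
Qed.

Lemma U_trunc_de_bruyn T y : tau < T -> 1 < y ->
  let s := (1 - F T + (y * C T)^-1) `^ (- alpha^-1) in
  U_trunc alpha tau ellF T y = s * de_bruyn l s.
Proof.
move=> tT y1 s; rewrite de_bruynE; first exact: U_truncE.
rewrite gt_eqF// powR_gt0// addr_gt0 ?(pareto_tail_gt0 F_pareto)//.
by rewrite invr_gt0 mulr_gt0 ?C_gt0// (lt_trans ltr01).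
Qed.

Lemma mul_ell_tau_lt w : 0 < w -> w < 1 - F tau ->
  tau * l tau < w `^ (- alpha^-1).
Proof.
move=> w0 wt; rewrite (mul_ellE alpha_gt0 F_pareto)// ltNge.
by rewrite le_powRN ?invr_gt0 ?(pareto_tail_gt0 F_pareto)// -ltNge.
Qed.

(** A level w below 1 - F tau is reached by 1 - F only to the right of tau > 0,
    which keeps the generalized inverse away from 0. *)
Lemma de_bruyn_level_neq0 w : 0 < w -> w < 1 - F tau ->
  de_bruyn l (w `^ (- alpha^-1)) != 0.
Proof.
move=> w0 wt; apply: (@de_bruyn_neq0 _ _ _ _ tau).
- exact: (mul_ell_nd alpha_gt0 F_pareto).
- exact: (mul_ell_cvgy alpha_gt0 F_pareto).
- exact: tau_gt0.
- by rewrite powR_gt0.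
- exact: mul_ell_tau_lt.
Qed.

End Truncation.

(** * Asymptotics of the tail quantile function *)

(* The joint limit "y, T -> oo" is taken along an arbitrary proper filter G. *)
Theorem proposition1 (R : realType) (alpha tau : R)
    (F : cumulativeBounded (0 : R) (1 : R)) (ellF : R -> R)
    (alpha_gt0 : 0 < alpha) (tau_gt0 : 0 < tau)
    (F_pareto : pareto_type F alpha ellF)
    (FT_continuous : forall T : R, tau < T ->
       continuous (F_trunc alpha tau ellF T)) :
  let l := ell alpha ellF in
  let lstar := de_bruyn l in
  let C := C_trunc alpha tau ellF in
  let D := D_trunc alpha tau ellF in
  let U := U_trunc alpha tau ellF in
  forall (I : Type) (G : set_system I) (FG : ProperFilter G) (y T : I -> R),
  y i @[i --> G] --> +oo ->
  T i @[i --> G] --> +oo ->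
  (* (a) *)
  ((exists2 c : R, 0 < c & \forall i \near G, c <= y i * D (T i)) ->
    [/\ forall i, 1 < y i -> tau < T i ->
          U (T i) (y i) =
            T i * (1 + (D (T i) * y i)^-1) `^ (- alpha^-1)
            * (l (T i) * lstar (T i * l (T i)))
            * (lstar (T i * l (T i) * (1 + (D (T i) * y i)^-1) `^ (- alpha^-1))
               / lstar (T i * l (T i))),
        l (T i) * lstar (T i * l (T i)) @[i --> G] --> (1 : R) &
        lstar (T i * l (T i) * (1 + (D (T i) * y i)^-1) `^ (- alpha^-1))
          / lstar (T i * l (T i)) @[i --> G] --> (1 : R)]) /\
  (* (b) *)
  (y i * D (T i) @[i --> G] --> (0 : R) ->
    (forall i, 1 < y i -> tau < T i ->
       U (T i) (y i) =
         (y i * C (T i)) `^ alpha^-1 * lstar ((y i * C (T i)) `^ alpha^-1)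
         * (1 + D (T i) * y i) `^ (- alpha^-1)
         * (lstar ((y i * C (T i)) `^ alpha^-1
                   * (1 + D (T i) * y i) `^ (- alpha^-1))
            / lstar ((y i * C (T i)) `^ alpha^-1))) /\
    lstar ((y i * C (T i)) `^ alpha^-1 * (1 + D (T i) * y i) `^ (- alpha^-1))
      / lstar ((y i * C (T i)) `^ alpha^-1) @[i --> G] --> (1 : R)).
Proof.
move=> l lstar C D U I G FG y T yy Ty.
have k_nd := mul_ell_nd alpha_gt0 F_pareto.
have k_y := mul_ell_cvgy alpha_gt0 F_pareto.
have l_sv := ell_slowly_varying F_pareto.
have tail0 x : 0 < 1 - F x by exact: (pareto_tail_gt0 F_pareto).
have near_tT : \forall i \near G, tau < T i by exact: (cvgry_gt Ty tau).
have near_y1 : \forall i \near G, 1 < y i by exact: (cvgry_gt yy 1).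
have C0 t : tau < t -> 0 < C t.
  exact: (C_gt0 tau_gt0 F_pareto FT_continuous).
have DE t : tau < t -> D t = C t * (1 - F t).
  exact: (D_truncE alpha_gt0 tau_gt0 F_pareto).
have D0 t : tau < t -> 0 < D t by move=> tt; rewrite DE// mulr_gt0// C0.
have UE i : 1 < y i -> tau < T i ->
  let s := (1 - F (T i) + (y i * C (T i))^-1) `^ (- alpha^-1) in
  U (T i) (y i) = s * lstar s.
  move=> yi Ti.
  exact: (U_trunc_de_bruyn alpha_gt0 tau_gt0 F_pareto FT_continuous Ti yi).
split=> [[c c0 yD]|yD0]; split.
- move=> i yi Ti; have y0 : 0 < y i := lt_trans ltr01 yi.
  have T0 := lt_trans tau_gt0 Ti.
  have Di := D0 _ Ti; have Ci := C0 _ Ti; have Si := tail0 (T i).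
  have sE : (1 - F (T i) + (y i * C (T i))^-1) `^ (- alpha^-1) =
      T i * l (T i) * (1 + (D (T i) * y i)^-1) `^ (- alpha^-1).
    rewrite (mul_ellE alpha_gt0 F_pareto)// -powRM; last 2 first.
    - exact: ltW.
    - by rewrite addr_ge0// invr_ge0 ltW// mulr_gt0.
    congr (_ `^ _); rewrite DE//; field.
    by rewrite !gt_eqF.
  have ls0 : lstar (T i * l (T i)) != 0.
    rewrite /l (mul_ellE alpha_gt0 F_pareto)//.
    apply: (de_bruyn_level_neq0 alpha_gt0 tau_gt0 F_pareto) => //.
    by rewrite ltrD2l ltrN2 (F_tau_lt tau_gt0 F_pareto FT_continuous).
  rewrite UE//= sE; set r := _ `^ _; set L := lstar (_ * r).
  by field.
- exact: cvg_comp Ty (de_bruyn_cvg_self k_nd k_y l_sv).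
- have p0 : 0 < (1 + c^-1) `^ (- alpha^-1).
    by rewrite powR_gt0// addr_gt0// invr_gt0.
  apply: (de_bruyn_cvg_scale k_nd k_y l_sv (q := 1) _ p0).
    exact: cvg_comp Ty k_y.
  near=> i.
  have cD : c <= D (T i) * y i by rewrite mulrC; near: i.
  have Dy0 : 0 < D (T i) * y i by exact: lt_le_trans cD.
  have i0 : 0 < (D (T i) * y i)^-1 by rewrite invr_gt0.
  rewrite le_powRN ?invr_gt0 ?addr_gt0 ?invr_gt0// lerD2l lef_pV2 ?posrE// cD/=.
  by apply: powRN_le1; rewrite ?invr_gt0// lerDl ltW.
- move=> i yi Ti; have y0 : 0 < y i := lt_trans ltr01 yi.
  have Di := D0 _ Ti; have Ci := C0 _ Ti; have Si := tail0 (T i).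
  have yC0 : 0 < (y i * C (T i))^-1 by rewrite invr_gt0 mulr_gt0.
  have s0E : (y i * C (T i)) `^ alpha^-1 = (y i * C (T i))^-1 `^ (- alpha^-1).
    by rewrite powRV ?opprK// ltW// mulr_gt0.
  have sE : (1 - F (T i) + (y i * C (T i))^-1) `^ (- alpha^-1) =
      (y i * C (T i)) `^ alpha^-1 * (1 + D (T i) * y i) `^ (- alpha^-1).
    rewrite s0E -powRM; last 2 first.
    - exact: ltW.
    - by rewrite addr_ge0// ltW// mulr_gt0.
    congr (_ `^ _); rewrite DE//; field.
    by rewrite !gt_eqF.
  have ls0 : lstar ((y i * C (T i)) `^ alpha^-1) != 0.
    rewrite s0E; apply: (de_bruyn_level_neq0 alpha_gt0 tau_gt0 F_pareto) => //.
    have := level_lt tau_gt0 F_pareto FT_continuous Ti yi.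
    by rewrite -/C; lra.
  rewrite UE//= sE; set r := _ `^ (- _); set L := lstar (_ * r).
  by field.
- have p0 : 0 < (2 : R) `^ (- alpha^-1) by rewrite powR_gt0.
  apply: (de_bruyn_cvg_scale k_nd k_y l_sv (q := 1) _ p0).
    have aV0 : 0 < alpha^-1 by rewrite invr_gt0.
    apply: (powR_cvgy _ aV0).
    have kV0 : 0 < (1 - F tau)^-1 by rewrite invr_gt0.
    (* C_T = 1 / (F T - F tau) is at least 1 / (1 - F tau). *)
    apply: (@ger_cvgy _ _ _ _ (fun i => (1 - F tau)^-1 * y i)); last first.
      apply/cvgryPge => A; near=> i; rewrite -ler_pdivrMl//.
      by near: i; exact: (cvgry_ge yy).
    near=> i.
    have Ti : tau < T i by near: i.
    have y0 : 0 < y i by apply: lt_trans ltr01 _; near: i.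
    have dF0 : 0 < F (T i) - F tau.
      by rewrite subr_gt0 (F_tau_lt tau_gt0 F_pareto FT_continuous).
    rewrite mulrC ler_pM2l// /C (C_truncE tau_gt0 F_pareto)//.
    by rewrite lef_pV2 ?posrE// lerD2r (F_le1 F).
  have near_yD : \forall i \near G, y i * D (T i) <= 1.
    by exact: (cvgr_le _ yD0 _ ltr01).
  near=> i.
  have Ti : tau < T i by near: i.
  have yi : 1 < y i by near: i.
  have Dy0 : 0 < D (T i) * y i by rewrite mulr_gt0 ?D0// (lt_trans ltr01).
  rewrite le_powRN ?invr_gt0 ?addr_gt0//.
  have -> /= : 1 + D (T i) * y i <= 2.
    by rewrite mulrC -[leRHS]/(1 + 1) lerD2l; near: i.
  by apply: powRN_le1; rewrite ?invr_gt0// lerDl ltW.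
Unshelve. all: by end_near. Qed.
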